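(* Let $\epsilon=\frac14$ and define $r_0=0$, $r_1=1$ and $r_k=\frac{r_{k-1}}{1-\sqrt{2\epsilon}}$ for $k\ge2$. Let $P=\sum_{k=0}^\infty p_k\delta_{r_k}$ be the discrete probability distribution on $\mathbb{R}$ with $$p_k=2\sqrt{\frac{\epsilon}{\pi}}\,e^{-\epsilon r_k^2}\quad(k\ge1),\qquad p_0=1-\sum_{k=1}^\infty p_k .$$ Let $S\sim P$ and $Y=S+Z$, where $Z\sim\mathcal{N}_1$ is independent of $S$. Then $I_{\chi^2}(S;Y)=\infty$. Consequently, $$\mathbb{E}_{P^{\otimes n}}\,\chi^2\big(\hat P_{S^n}\ast\mathcal{N}_1\,\big\|\,P\ast\mathcal{N}_1\big)=\infty\qquad\text{for all } n\in\mathbb{N}.$$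
   Context: $\delta_x$ is the Dirac measure at $x$. $\mathcal{N}_1=\mathcal{N}(0,1)$ is the standard Gaussian on $\mathbb{R}$; $S^n=(S_1,\dots,S_n)\sim P^{\otimes n}$; $\hat P_{S^n}=\frac1n\sum_{i=1}^n\delta_{S_i}$; $\ast$ is convolution of measures. $\chi^2(\mu\|\nu)=\int\big(\frac{d\mu}{d\nu}-1\big)^2d\nu$. The $\chi^2$ mutual information is $I_{\chi^2}(S;Y)=\chi^2(P_{S,Y}\|P_S\otimes P_Y)$, where $P_{S,Y}$ is the joint law of $(S,Y)$ and $P_S,P_Y$ are its marginals. *)

(* Defs.v *)
From HB Require Import structures.
From mathcomp Require Import all_boot all_order all_algebra.
From mathcomp Require Import all_classical all_reals all_analysis.
From mathcomp Require Import ring lra.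
Import Order.TTheory GRing.Theory Num.Theory.
Import numFieldNormedType.Exports.

Set Implicit Arguments.
Unset Strict Implicit.
Unset Printing Implicit Defensive.

Local Open Scope classical_set_scope.
Local Open Scope ring_scope.

Section chi2_divergence.
Local Open Scope ereal_scope.
Local Open Scope charge_scope.
Context d (T : measurableType d) (R : realType).

(* The formula presupposes that mu has a density with respect to nu; the usual
   value +oo is taken otherwise. *)
Definition chi2 (mu nu : probability T R) : \bar R :=
  if pselect (mu `<< nu) then
    \int[nu]_x (('d (charge_of_finite_measure mu) '/d nu) x - 1) ^+ 2
  else +oo.

End chi2_divergence.

Section random_variables.
Context d d1 d2 (T : measurableType d) (T1 : measurableType d1)
  (T2 : measurableType d2) (R : realType) (Pr : probability T R).

(* Equality of laws is only required on measurable sets: the values of these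
   set functions elsewhere are meaningless. *)
Definition has_law (X : {RV Pr >-> T1}) (mu : probability T1 R) : Prop :=
  forall A, measurable A -> distribution Pr X A = mu A.

Definition independent (X : {RV Pr >-> T1}) (Y : {RV Pr >-> T2}) : Prop :=
  forall A B, measurable A -> measurable B ->
    Pr (X @^-1` A `&` Y @^-1` B) = (Pr (X @^-1` A) * Pr (Y @^-1` B))%E.

Definition pairRV (X : {RV Pr >-> T1}) (Y : {RV Pr >-> T2}) (w : T) : T1 * T2 :=
  (X w, Y w).

Section pairRV_measurable.
Variables (X : {RV Pr >-> T1}) (Y : {RV Pr >-> T2}).

Let measurable_pairRV : measurable_fun [set: T] (pairRV X Y).
Proof. by apply: measurable_fun_pair; exact: measurable_funP. Qed.

HB.instance Definition _ :=
  isMeasurableFun.Build _ _ _ _ (pairRV X Y) measurable_pairRV.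

End pairRV_measurable.

Definition chi2_information (X : {RV Pr >-> T1}) (Y : {RV Pr >-> T2}) :
    \bar R :=
  chi2 (distribution Pr (pairRV X Y))
       (distribution Pr X \x distribution Pr Y)%E.

End random_variables.

Section convolution.
Context (R : realType).

Definition pair_add (xy : R * R) : R := xy.1 + xy.2.

Let measurable_pair_add : measurable_fun [set: R * R] pair_add.
Proof.
by apply: measurable_realfun.measurable_funD;
  [exact: measurable_fst|exact: measurable_snd].
Qed.

HB.instance Definition _ :=
  isMeasurableFun.Build _ _ _ _ pair_add measurable_pair_add.

Definition convolution (mu nu : probability R R) : probability R R :=
  distribution (mu \x nu)%E pair_add.

End convolution.

Section std_gaussian.
Context (R : realType).

(* normal_prob lives on measurableTypeR R, a copy of R that carries the same
   sigma-algebra under another display. *)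
Definition std_gaussian : set R -> \bar R := normal_prob 0 1.

Let std_gaussian0 : std_gaussian set0 = 0%E.
Proof. exact: measure0. Qed.

Let std_gaussian_ge0 A : (0 <= std_gaussian A)%E.
Proof. exact: measure_ge0. Qed.

Let std_gaussian_sigma_additive : semi_sigma_additive std_gaussian.
Proof. exact: (@measure_semi_sigma_additive _ _ _ (normal_prob 0 1)). Qed.

HB.instance Definition _ := isMeasure.Build _ _ _ std_gaussian
  std_gaussian0 std_gaussian_ge0 std_gaussian_sigma_additive.

Let std_gaussian_setT : std_gaussian [set: R] = 1%E.
Proof. exact: (@probability_setT _ _ _ (normal_prob 0 1)). Qed.

HB.instance Definition _ :=
  Measure_isProbability.Build _ _ _ std_gaussian std_gaussian_setT.

End std_gaussian.
Arguments std_gaussian R A : clear implicits.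

Section power_probability.
Context d (T : measurableType d) (R : realType).

Definition tuple_cons n (xs : T * n.-tuple T) : n.+1.-tuple T :=
  [tuple of xs.1 :: xs.2].

Section tuple_cons_measurable.
Variable n : nat.

Let measurable_tuple_cons :
  measurable_fun [set: T * n.-tuple T] (@tuple_cons n).
Proof.
by apply: measurable_cons; [exact: measurable_fst|exact: measurable_snd].
Qed.

HB.instance Definition _ :=
  isMeasurableFun.Build _ _ _ _ (@tuple_cons n) measurable_tuple_cons.

End tuple_cons_measurable.

Fixpoint power_probability (P : probability T R) n :
    probability (n.-tuple T) R :=
  match n with
  | 0 => dirac [tuple]
  | m.+1 => distribution (P \x power_probability P m)%E (@tuple_cons m)
  end.

Lemma power_probability_box (P : probability T R) n (A : 'I_n -> set T) :
  (forall i, measurable (A i)) ->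
  power_probability P n [set s | forall i, A i (tnth s i)] =
  (\prod_(i < n) P (A i))%E.
Proof.
have mbox m (B : 'I_m -> set T) : (forall i, measurable (B i)) ->
    measurable [set s : m.-tuple T | forall i, B i (tnth s i)].
  move=> mB; rewrite (_ : mkset _ =
      \bigcap_(i in [set: 'I_m]) ((fun s : m.-tuple T => tnth s i) @^-1` B i)).
    apply: fin_bigcap_measurable => // i _; rewrite -[_ @^-1` _]setTI.
    exact: measurable_tnth.
  by apply/seteqP; split => s Hs i => [_|]; [exact: Hs|exact: (Hs i I)].
elim: n A => [|n IH] A mA /=.
  by rewrite big_ord0 diracE mem_set// => -[].
rewrite big_ord_recl -IH; last by move=> i; exact: mA.
have mA' := mbox _ _ (fun i => mA (lift ord0 i)).
rewrite -(product_measure1E _ _ (mA ord0) mA').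
rewrite /distribution /pushforward; congr (product_measure1 _ _ _).
apply/seteqP; split => -[x s] /=.
  move=> H; split; first exact: (H ord0).
  by move=> i; have := H (lift ord0 i); rewrite tnthS.
by move=> [H0 H] i; case: (unliftP ord0 i) => [j ->|->]; rewrite ?tnthS.
Qed.

End power_probability.

Section empirical_measure.
Local Open Scope ereal_scope.
Context d (T : measurableType d) (R : realType).
Variables (n : nat) (s : n.+1.-tuple T).

Definition empirical (A : set T) : \bar R :=
  (n.+1%:R^-1)%R%:E * \sum_(i < n.+1) \d_(tnth s i) A.

Let empirical0 : empirical set0 = 0.
Proof. by rewrite /empirical big1 ?mule0// => i _; rewrite measure0. Qed.

Let empirical_ge0 A : 0 <= empirical A.
Proof. by apply: mule_ge0; [rewrite lee_fin|exact: sume_ge0]. Qed.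

Let empirical_sigma_additive : semi_sigma_additive empirical.
Proof.
have n0 : (0 <= n.+1%:R^-1 :> R)%R by [].
pose m := mscale (NngNum n0)
  (msum (fun k => \d_(tnth s (inord k)) : {measure set T -> \bar R}) n.+1).
rewrite (_ : empirical = m); first exact: measure_semi_sigma_additive.
apply/funext => A; rewrite /empirical /m /mscale /msum/=; congr (_ * _).
by apply: eq_bigr => i _; rewrite inord_val.
Qed.

HB.instance Definition _ := isMeasure.Build _ _ _ empirical
  empirical0 empirical_ge0 empirical_sigma_additive.

Let empirical_setT : empirical [set: T] = 1.
Proof.
rewrite /empirical (eq_bigr (fun=> 1%R%:E)) => [|i _]; last by rewrite diracT.
by rewrite sumEFin sumr_const card_ord -EFinM mulVf// pnatr_eq0.
Qed.

HB.instance Definition _ :=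
  Measure_isProbability.Build _ _ _ empirical empirical_setT.

End empirical_measure.
Arguments empirical {d T} R {n} s A.

Section discrete_distribution.
Context (R : realType).

Definition eps : R := 4^-1.

Fixpoint atom (k : nat) : R :=
  match k with
  | 0 => 0
  | 1 => 1
  | j.+1 => atom j / (1 - Num.sqrt (2 * eps))
  end.

Definition weight (k : nat) : R :=
  2 * Num.sqrt (eps / pi) * expR (- eps * atom k ^+ 2).

Definition mass (k : nat) : R :=
  if k is 0 then 1 - limn (fun n => \sum_(1 <= j < n) weight j) else weight k.

Definition discrete_law (A : set R) : \bar R :=
  (\sum_(0 <= k <oo) (mass k)%:E * \d_(atom k) A)%E.

Let weight_ge0 k : 0 <= weight k.
Proof. by rewrite !mulr_ge0 ?expR_ge0 ?sqrtr_ge0. Qed.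

Let ratio_ge3 : 3 <= (1 - Num.sqrt (2 * eps))^-1.
Proof.
have s2 : Num.sqrt (2 * eps) ^+ 2 = 2^-1.
  by rewrite sqr_sqrtr /eps; [field|rewrite mulr_ge0].
have s0 := sqrtr_ge0 (2 * eps).
have ? : 0 < 1 - Num.sqrt (2 * eps) by nra.
rewrite -[3]invrK lef_pV2 ?posrE ?invr_gt0//; nra.
Qed.

Let atomS_ge1 k : 1 <= atom k.+1.
Proof.
elim: k => [|k IH]; first by [].
change (1 <= atom k.+1 / (1 - Num.sqrt (2 * eps))).
have := ratio_ge3; nra.
Qed.

Let weightSS k : weight k.+2 <= weight k.+1 / 3.
Proof.
rewrite /weight -[leRHS]mulrA ler_wpM2l ?mulr_ge0 ?sqrtr_ge0//.
have a1 := atomS_ge1 k.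
have a3 : 3 * atom k.+1 <= atom k.+2.
  change (3 * atom k.+1 <= atom k.+1 / (1 - Num.sqrt (2 * eps))).
  have := ratio_ge3; nra.
apply: (@le_trans _ _ (expR (- eps * atom k.+1 ^+ 2 - 2))).
  by rewrite ler_expR /eps; nra.
rewrite expRD ler_wpM2l ?expR_ge0// expRN lef_pV2 ?posrE ?expR_gt0//.
by apply: le_trans (expR_ge1Dx 2); lra.
Qed.

Let weight1 : weight 1 <= 3 / 5.
Proof.
have e1 : expR (- eps * atom 1 ^+ 2) <= 4 / 5.
  rewrite /= expr1n mulr1 expRN -[leRHS]invrK lef_pV2 ?posrE ?expR_gt0//.
  apply: le_trans (expR_ge1Dx _); rewrite /eps; lra.
have s1 : 2 * Num.sqrt (eps / pi) <= 3 / 4.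
  have pi2 := pi_ge2 R.
  have pV : pi^-1 <= 2^-1 :> R by rewrite lef_pV2 ?posrE ?pi_gt0.
  have pV0 : 0 <= pi^-1 :> R by rewrite invr_ge0 pi_ge0.
  have s0 := sqrtr_ge0 (eps / pi).
  have s2 : Num.sqrt (eps / pi) ^+ 2 = eps / pi.
    by rewrite sqr_sqrtr// mulr_ge0// /eps.
  move: s2; rewrite /eps; nra.
have s0 : 0 <= 2 * Num.sqrt (eps / pi) by rewrite mulr_ge0 ?sqrtr_ge0.
have e0 := expR_ge0 (- eps * atom 1 ^+ 2).
rewrite /weight; nra.
Qed.

Let sum_weight n : \sum_(1 <= j < n) weight j <= 1.
Proof.
suff H m : \sum_(1 <= j < m.+1) weight j + weight m.+1 * (3 / 2) <= 9 / 10.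
  case: n => [|n]; first by rewrite big_geq.
  have := H n; have := weight_ge0 n.+1; lra.
elim: m => [|m IH]; first by rewrite big_geq// add0r; have := weight1; lra.
rewrite big_nat_recr//=; have := weightSS m; have := weight_ge0 m.+1.
by move: IH; lra.
Qed.

Let cvg_weight : cvgn (fun n => \sum_(1 <= j < n) weight j).
Proof.
apply: nondecreasing_is_cvgn; last by exists 1 => _ [n _ <-].
apply/nondecreasing_seqP => -[|n]; first by rewrite !big_geq.
by rewrite [leRHS]big_nat_recr//= lerDl.
Qed.

Let mass_ge0 k : 0 <= mass k.
Proof.
case: k => [|k]; last exact: weight_ge0.
by rewrite subr_ge0; apply: limr_le => //; exact: nearW.
Qed.

Let discrete_law_measure : discrete_law =
  mseries (fun k => mscale (NngNum (mass_ge0 k)) \d_(atom k)) 0.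
Proof. by []. Qed.

Let discrete_law0 : discrete_law set0 = 0%E.
Proof. by rewrite discrete_law_measure measure0. Qed.

Let discrete_law_ge0 A : (0 <= discrete_law A)%E.
Proof. by rewrite discrete_law_measure. Qed.

Let discrete_law_sigma_additive : semi_sigma_additive discrete_law.
Proof. by rewrite discrete_law_measure; exact: measure_semi_sigma_additive. Qed.

HB.instance Definition _ := isMeasure.Build _ _ _ discrete_law
  discrete_law0 discrete_law_ge0 discrete_law_sigma_additive.

Let discrete_law_setT : discrete_law [set: R] = 1%E.
Proof.
pose w n := \sum_(1 <= j < n) weight j.
have massE :
  (fun n => \sum_(0 <= k < n.+1) (mass k)%:E * \d_(atom k) [set: R])%E =
    EFin \o (fun n => (1 - limn w) + w n.+1).
  apply/funext => n /=; rewrite big_ltn// diracT mule1 [RHS]EFinD.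
  congr (_ + _)%E.
  rewrite -sumEFin; apply: eq_big_nat => -[//|k] _.
  by rewrite diracT mule1.
apply/cvg_lim => //; rewrite -cvg_shiftS massE.
apply: cvg_EFin; first exact: nearW.
rewrite [X in _ --> X](_ : _ = 1 - limn w + limn w); last by rewrite subrK.
by apply: cvgD; [exact: cvg_cst|rewrite cvg_shiftS].
Qed.

HB.instance Definition _ :=
  Measure_isProbability.Build _ _ _ discrete_law discrete_law_setT.

End discrete_distribution.
Arguments discrete_law R A : clear implicits.

(* Main.v *)
Require Import Defs.
From mathcomp Require Import all_boot all_order all_algebra.
From mathcomp Require Import all_classical all_reals all_analysis.
From mathcomp Require Import measurable_realfun.
From mathcomp Require Import ring lra.
Import Order.TTheory GRing.Theory Num.Theory.
Import numFieldNormedType.Exports.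

Set Implicit Arguments.
Unset Strict Implicit.
Unset Printing Implicit Defensive.

Local Open Scope classical_set_scope.
Local Open Scope ring_scope.

(** The chi-square divergence dominates what it sees on disjoint events: if
mu E_k >= a_k and nu E_k <= b_k with 2 b_k <= a_k, then
chi2 mu nu >= sum_k a_k^2 / (4 b_k) ([sum_le_chi2]). This is the data
processing inequality up to a constant. It turns both claims into estimates of
the probability of a few explicit events, so that no density ever has to be
computed.

The events come from the windows W_k = [r_k + 1/2, r_k + 1]. The weights p_j are
proportional to exp (- r_j^2 / 4), so the contribution of the atom r_j to the
density of Y at y is proportional to exp (tilt j y) with
tilt j y = - r_j^2 / 4 - (y - r_j)^2 / 2. For y in W_k, the atoms being at least
tripled at each step, this is maximal at j = k and falls off by at least a
factor e at each step away from k ([tilt_peak]). The mass at 0 is of the same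
order as the k-th term as well. Hence the law Q of Y charges W_k hardly more
than the k-th atom alone does: Q W_k <= K p_k g ([convolution_window_le]), where
K does not depend on k and g is a lower bound for the standard Gaussian mass of
[1/2, 1].

- Mutual information: take E_k = {r_k} x W_k. The joint law gives it at least
  P{r_k} g, the product law at most P{r_k} K p_k g, and each k for which p_k is
  small contributes at least g / (4 K). The sum over k diverges.
- Empirical measure of n samples: if the first sample is r_k, then the smoothed
  empirical measure gives W_k at least g / n, so the divergence is at least
  g / (4 n^2 K p_k). This event has probability at least p_k, so each k
  contributes at least g / (4 n^2 K) to the expectation, and these events are
  disjoint. The integral of a nonnegative function being a supremum over
  simple functions, these contributions add up without a proof that the
  divergence is a measurable function of the sample ([sum_le_integral]). *)

(** * Lower bounds for integrals and for the chi-square divergence *)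

Section lower_bounds.
Import HBNNSimple.
Context d (T : measurableType d) (R : realType).
Local Open Scope ereal_scope.
Local Open Scope charge_scope.

(** The integral of a nonnegative function is a supremum over the simple functions
below it, which is monotone even for non-measurable functions. *)
Lemma ge0_le_integralT (mu : {measure set T -> \bar R}) (f g : T -> \bar R) :
  (forall x, 0 <= f x) -> (forall x, f x <= g x) ->
  \int[mu]_x f x <= \int[mu]_x g x.
Proof.
move=> f0 fg; have g0 x : 0 <= g x by exact: le_trans (f0 x) (fg x).
rewrite !ge0_integralTE//; apply: ereal_sup_le => _ [h hf <-].
by exists h => // x; exact: le_trans (hf x) (fg x).
Qed.

Lemma sum_le_integral (mu : {measure set T -> \bar R}) (f : T -> \bar R)
    (m : nat) (E : 'I_m -> set T) (v : 'I_m -> R) :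
  (forall x, 0 <= f x) -> (forall k, measurable (E k)) ->
  trivIset setT E -> (forall k, 0 <= v k)%R ->
  (forall k x, E k x -> (v k)%:E <= f x) ->
  \sum_(k < m) (v k)%:E * mu (E k) <= \int[mu]_x f x.
Proof.
move=> f0 mE tE v0 vf.
have ind0 k x : 0 <= (v k)%:E * (\1_(E k) x)%:E.
  by rewrite mule_ge0 ?lee_fin.
have mind k : measurable_fun setT (fun x => (\1_(E k) x)%:E).
  by apply/measurable_EFinP; exact: measurable_indic.
rewrite (_ : \sum_(k < m) _ =
    \int[mu]_x \sum_(k < m) (v k)%:E * (\1_(E k) x)%:E); last first.
  rewrite ge0_integral_sum//; last first.
    by move=> k; apply: measurable_funeM.
  apply: eq_bigr => k _; rewrite ge0_integralZl_EFin//.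
  by rewrite integral_indic// setIT.
apply: ge0_le_integralT => x; first by apply: sume_ge0 => k _.
have [[k Ekx]|nE] := pselect (exists k, E k x).
  rewrite (bigD1 k)//= indicE mem_set// mule1 big1 ?adde0; first exact: vf Ekx.
  move=> j jk; rewrite indicE memNset ?mule0//; move=> Ejx.
  by have /eqP := jk; apply; apply: tE => //; exists x.
rewrite big1// => k _; rewrite indicE memNset ?mule0// => Ekx.
by apply: nE; exists k.
Qed.

Lemma chi2_ge0 (mu nu : probability T R) : 0 <= chi2 mu nu.
Proof.
rewrite /chi2; case: pselect => // munu; apply: integral_ge0 => x _.
exact: sqre_ge0.
Qed.

Section density.
Variables (mu nu : probability T R).
Hypothesis munu : mu `<< nu.
Let f := 'd (charge_of_finite_measure mu) '/d nu.

Let ffin x : f x = (fine (f x))%:E.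
Proof. by rewrite fineK//; exact: Radon_Nikodym_fin_num. Qed.

Let mf : measurable_fun setT f.
Proof. by apply: (@measurable_int _ _ _ nu); exact: Radon_Nikodym_integrable. Qed.

Let gE x : (f x - 1) ^+ 2 = ((fine (f x) - 1) ^+ 2)%:E.
Proof. by rewrite {1}ffin -EFinB EFin_expe. Qed.

Let mg : measurable_fun setT (fun x => (f x - 1) ^+ 2).
Proof.
under eq_fun do rewrite gE.
apply/measurable_EFinP; apply: measurable_funX; apply: measurable_funB => //.
exact: measurableT_comp.
Qed.

(** Integrating (f - 1)^2 >= 2 l (f - 1) - l^2 over E gives, for l >= 0, the lower
bound 2 l (a - b) - l^2 b, whose maximum over l is (a - b)^2 / b; the assumption
2 b <= a bounds this below by (a / 2)^2 / b. *)
Lemma sqr_density_ge (E : set T) (a b : R) : measurable E ->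
  (0 < b)%R -> (2 * b <= a)%R -> a%:E <= mu E -> nu E <= b%:E ->
  (a ^+ 2 / (4 * b))%:E <= \int[nu]_(x in E) (f x - 1) ^+ 2.
Proof.
move=> mE b0 ab amu nub.
(* The maximizer of 2 l (a - b) - l^2 b. *)
pose l := ((a - b) / b)%R.
have l0 : (0 <= l)%R by rewrite divr_ge0//; lra.
have c0 : (0 <= 2 * l + l ^+ 2)%R by have := sqr_ge0 l; lra.
have muE : mu E = \int[nu]_(x in E) f x.
  by rewrite -Radon_Nikodym_integral.
have mfE : measurable_fun E f by exact: measurable_funTS.
have mgE : measurable_fun E (fun x => (f x - 1) ^+ 2) by exact: measurable_funTS.
(* The subtracted terms are moved to the right and f is replaced by its absolute
   value, so that both integrands are nonnegative. *)
have key : (2 * l)%:E * mu E <=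
    \int[nu]_(x in E) (f x - 1) ^+ 2 + (2 * l + l ^+ 2)%:E * nu E.
  rewrite -(integral_cst nu mE (2 * l + l ^+ 2)%:E) -ge0_integralD//;
    last by move=> x _; exact: sqre_ge0.
  apply: (@le_trans _ _ (\int[nu]_(x in E) ((2 * l)%:E * `|f x|))).
    rewrite ge0_integralZl_EFin//; last 2 first.
      exact: measurableT_comp.
      by rewrite mulr_ge0.
    apply: lee_wpmul2l; first by rewrite lee_fin mulr_ge0.
    rewrite muE; apply: le_trans (lee_abs _) _; exact: le_abse_integral.
  apply: ge0_le_integral => //.
    by move=> x _; apply: mule_ge0 => //; rewrite lee_fin mulr_ge0.
    by apply: measurable_funeM; exact: measurableT_comp.
    by apply: emeasurable_funD.
  move=> x _; rewrite gE {1}ffin lee_fin.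
  set y := fine _; have [y0|y0] := leP 0%R y.
    rewrite ger0_norm//; have := sqr_ge0 (y - 1 - l); nra.
  rewrite ltr0_norm//; have := sqr_ge0 (- y - 1 - l); nra.
have : (2 * l * a)%:E <= \int[nu]_(x in E) (f x - 1) ^+ 2 +
    ((2 * l + l ^+ 2) * b)%:E.
  rewrite (EFinM (2 * l)) (EFinM (2 * l + l ^+ 2)); apply: le_trans (le_trans _ key) _.
    by apply: lee_wpmul2l => //; rewrite lee_fin mulr_ge0.
  by apply: leeD => //; apply: lee_wpmul2l => //; rewrite lee_fin.
rewrite -leeBlDr// -EFinB; apply: le_trans; rewrite lee_fin.
have lb : (l * b = a - b)%R by rewrite divfK// gt_eqF.
have -> : (2 * l * a - (2 * l + l ^+ 2) * b = (a - b) ^+ 2 / b)%R.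
  by rewrite /l; field; rewrite gt_eqF.
rewrite (_ : a ^+ 2 / (4 * b) = (a / 2) ^+ 2 / b)%R; last first.
  by field; rewrite gt_eqF.
by rewrite ler_pM2r ?invr_gt0// ler_sqr ?nnegrE; lra.
Qed.

Lemma sum_le_sqr_density (m : nat) (E : 'I_m -> set T) (a b : 'I_m -> R) :
  (forall k, measurable (E k)) -> trivIset setT E ->
  (forall k, 0 < b k)%R -> (forall k, 2 * b k <= a k)%R ->
  (forall k, (a k)%:E <= mu (E k)) -> (forall k, nu (E k) <= (b k)%:E) ->
  \sum_(k < m) ((a k) ^+ 2 / (4 * b k))%:E <= \int[nu]_x (f x - 1) ^+ 2.
Proof.
move=> mE tE b0 ab amu nub.
pose D := \big[setU/set0]_(k < m) E k.
have mD : measurable D by exact: bigsetU_measurable.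
apply: (@le_trans _ _ (\int[nu]_(x in D) (f x - 1) ^+ 2)); last first.
  by apply: ge0_subset_integral => // x _; exact: sqre_ge0.
rewrite ge0_integral_bigsetU//=; last 4 first.
  exact: index_enum_uniq.
  by apply: sub_trivIset tE.
  exact: measurable_funTS.
  by move=> x _; exact: sqre_ge0.
by apply: lee_sum => k _; exact: sqr_density_ge.
Qed.

End density.

(** When mu is not dominated by nu, the divergence is infinite. *)
Lemma sum_le_chi2 (mu nu : probability T R) (m : nat) (E : 'I_m -> set T)
    (a b : 'I_m -> R) :
  (forall k, measurable (E k)) -> trivIset setT E ->
  (forall k, 0 < b k)%R -> (forall k, 2 * b k <= a k)%R ->
  (forall k, (a k)%:E <= mu (E k)) -> (forall k, nu (E k) <= (b k)%:E) ->
  \sum_(k < m) ((a k) ^+ 2 / (4 * b k))%:E <= chi2 mu nu.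
Proof.
move=> mE tE b0 ab amu nub; rewrite /chi2; case: pselect => [munu|nmunu].
  exact: sum_le_sqr_density.
by rewrite leey.
Qed.

End lower_bounds.

(** * The atoms and their Gaussian tilts *)

Section ladder.
Context (R : realType).
Local Notation r := (atom R).

Definition weight_const : R := 2 * Num.sqrt (eps R / pi).
Local Notation c := weight_const.

Lemma weight_const_gt0 : 0 < c.
Proof. by rewrite mulr_gt0// sqrtr_gt0 divr_gt0 ?pi_gt0// /eps. Qed.

Lemma weightE k : weight R k = c * expR (- eps R * r k ^+ 2).
Proof. by []. Qed.

Lemma weight_gt0 k : 0 < weight R k.
Proof. by rewrite weightE mulr_gt0 ?expR_gt0 ?weight_const_gt0. Qed.

Lemma ratio_ge3 : 3 <= (1 - Num.sqrt (2 * eps R))^-1.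
Proof.
have s2 : Num.sqrt (2 * eps R) ^+ 2 = 2^-1.
  by rewrite sqr_sqrtr /eps; [field|rewrite mulr_ge0].
have s0 := sqrtr_ge0 (2 * eps R).
have ? : 0 < 1 - Num.sqrt (2 * eps R) by nra.
rewrite -[3]invrK lef_pV2 ?posrE ?invr_gt0//; nra.
Qed.

Lemma atomS_ge1 k : 1 <= r k.+1.
Proof.
elim: k => [//|k IH]; rewrite -[r k.+2]/(r k.+1 / (1 - Num.sqrt (2 * eps R))).
have := ratio_ge3; nra.
Qed.

Lemma atomSS_ge3 k : 3 * r k.+1 <= r k.+2.
Proof.
rewrite -[r k.+2]/(r k.+1 / (1 - Num.sqrt (2 * eps R))).
have := ratio_ge3; have := atomS_ge1 k; nra.
Qed.

Lemma atom_ge1D k : r k + 1 <= r k.+1.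
Proof.
case: k => [|k]; first by rewrite add0r.
have := atomSS_ge3 k; have := atomS_ge1 k; lra.
Qed.

Lemma atom_ge_nat k : k%:R <= r k.
Proof.
elim: k => [//|k IH]; rewrite -natr1.
by apply: le_trans (atom_ge1D k); rewrite lerD2r.
Qed.

Lemma atomD_ge j i : r j + i%:R <= r (j + i)%N.
Proof.
elim: i => [|i IH]; first by rewrite addr0 addn0.
rewrite -natr1 addnS; apply: le_trans (atom_ge1D _); lra.
Qed.

Lemma atom_separated j k : (j < k)%N -> r j + 1 <= r k.
Proof.
move=> jk; have := atomD_ge j (k - j)%N; rewrite subnKC 1?ltnW//.
apply: le_trans; rewrite lerD2l.
by rewrite -[1]/(1%:R) ler_nat subn_gt0.
Qed.

Lemma atom_inj : injective r.
Proof.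
have sep a b : (a < b)%N -> r a <> r b by move=> /atom_separated; lra.
by move=> j k; have [/sep|/sep/nesym|] := ltngtP j k.
Qed.

(** The offset 1/2 to the right of the atom makes the lower atoms negligible on
the window as soon as each atom is at least three times the previous one. *)
Definition window k : set R := `[r k + 2^-1, r k + 1].

(** Up to a constant factor independent of j, [expR (tilt j y)] is the weight of
the atom j times the standard Gaussian density at [y - r j]. *)
Definition tilt j (y : R) : R := - eps R * r j ^+ 2 - (y - r j) ^+ 2 / 2.

(** With a < b consecutive atoms, tilt b - tilt a is
(b - a) (y - 3/4 (a + b)), and 3/4 (a + b) <= b because 3 a <= b. *)
Lemma tilt_increasing j y : r j.+2 + 2^-1 <= y -> tilt j.+1 y + 1 <= tilt j.+2 y.
Proof.
move=> ry; rewrite /tilt /eps.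
have := atomSS_ge3 j; have := atomS_ge1 j.
move: ry; set a := r j.+1; set b := r j.+2 => *.
suff : 1 <= (b - a) * (y - 3 / 4 * (a + b)) by lra.
have : 1 * 1 <= 2 * a * (y - 3 / 4 * (a + b)) by nra.
nra.
Qed.

(** Same difference of tilts as above, now with y <= a + 1 <= 2 a, while
3/4 (a + b) >= 3 a. *)
Lemma tilt_decreasing j y : y <= r j.+1 + 1 -> tilt j.+2 y + 1 <= tilt j.+1 y.
Proof.
move=> ry; rewrite /tilt /eps.
have := atomSS_ge3 j; have := atomS_ge1 j.
move: ry; set a := r j.+1; set b := r j.+2 => *.
suff : 1 <= (b - a) * (3 / 4 * (a + b) - y) by lra.
have : 1 <= 3 / 4 * (a + b) - y by lra.
nra.
Qed.

(** In truncated subtraction, (j - k) + (k - j) is the distance of j and k. The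
index 0 is excluded: its mass is not given by the exponential formula. *)
Lemma tilt_peak j k y : (0 < j)%N -> (0 < k)%N -> y \in window k ->
  tilt j y <= tilt k y - ((j - k) + (k - j))%N%:R.
Proof.
move=> j0 k0; rewrite inE /window/= in_itv/= => /andP[y1 y2].
have [jk|kj] := leqP j k.
  rewrite (eqP jk) add0n -{1}(subnKC jk).
  have : r (j + (k - j))%N + 2^-1 <= y by rewrite subnKC.
  elim: (k - j)%N => [|i IH]; first by rewrite addn0 subr0.
  rewrite addnS => yi.
  have ri := atom_ge1D (j + i).
  have {}IH : tilt j y <= tilt (j + i) y - i%:R by apply: IH; lra.
  case: j j0 ri IH yi {jk} => // j _ ri IH yi.
  by have := tilt_increasing yi; rewrite -natr1 => ?; lra.
have kj' := ltnW kj.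
rewrite (eqP kj') addn0 -{1}(subnKC kj').
elim: (j - k)%N => [|i IH]; first by rewrite addn0 subr0.
rewrite addnS -natr1.
case: k k0 y1 y2 IH {kj kj'} => // k _ y1 y2 IH.
have yi : y <= r (k + i).+1 + 1.
  apply: le_trans y2 _; rewrite lerD2r -addSn.
  by apply: le_trans (atomD_ge _ _); rewrite lerDl.
by have := tilt_decreasing yi; rewrite addSn in IH *; lra.
Qed.

Lemma expRN_nat_le n : expR (- n%:R : R) <= 2^-1 ^+ n.
Proof.
elim: n => [|n IH]; first by rewrite oppr0 expR0 expr0.
rewrite -natr1 opprD expRD exprSr ler_pM ?expR_ge0//.
rewrite expRN lef_pV2 ?posrE ?expR_gt0//.
by have := expR_ge1Dx (1 : R); lra.
Qed.

Lemma sum_geometric_two_sided k n :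
  \sum_(1 <= j < n) 2^-1 ^+ ((j - k) + (k - j))%N <= 3 :> R.
Proof.
suff H m : \sum_(0 <= j < m) 2^-1 ^+ ((j - k) + (k - j))%N <= 3 :> R.
  case: n => [|n]; first by rewrite big_geq.
  by apply: le_trans (H n.+1); rewrite [leRHS]big_ltn// lerDr exprn_ge0 ?invr_ge0.
(* The terms below k add up to less than the next term of the series. *)
have below i : (i <= k)%N ->
    \sum_(0 <= j < i) 2^-1 ^+ ((j - k) + (k - j))%N <= 2^-1 ^+ (k - i) :> R.
  elim: i => [|i IH] ik; first by rewrite big_geq// exprn_ge0 ?invr_ge0.
  rewrite big_nat_recr//= (eqP (ltnW ik)) add0n.
  have := IH (ltnW ik); rewrite subnS; have : (0 < k - i)%N by rewrite subn_gt0.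
  by case: (k - i)%N => // p _ /=; rewrite exprS; lra.
have above i : \sum_(0 <= j < k + i) 2^-1 ^+ ((j - k) + (k - j))%N <=
    3 - 2 * 2^-1 ^+ i :> R.
  elim: i => [|i IH].
    by rewrite addn0; have := below k (leqnn k); rewrite subnn expr0; lra.
  rewrite addnS big_nat_recr//= addKn (eqP (leq_addr i k)) addn0 exprS.
  by move: IH; lra.
have [mk|/ltnW/subnKC<-] := leqP m k.
  apply: le_trans (below _ mk) _; apply: (@le_trans _ _ 1); last by rewrite ler1n.
  by apply: exprn_ile1 => //; lra.
apply: le_trans (above _) _; have := @exprn_ge0 R (m - k) 2^-1; lra.
Qed.

Lemma weight_le_inv k : (0 < k)%N -> weight R k <= 4 * c / k%:R.
Proof.
move=> k0; have kr : 0 < k%:R :> R by rewrite ltr0n.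
rewrite weightE [leRHS](_ : _ = c * (4 / k%:R)); last by ring.
rewrite ler_pM2l ?weight_const_gt0// -invf_div mulNr expRN.
rewrite lef_pV2 ?posrE ?expR_gt0 ?divr_gt0//.
apply: le_trans (expR_ge1Dx _); rewrite /eps.
have k1 : 1 <= k%:R :> R by rewrite ler1n.
have := atom_ge_nat k; nra.
Qed.

Lemma weight_eventually_small (x : R) :
  0 <= x -> exists k0, forall k, (k0 < k)%N -> x * weight R k <= 1.
Proof.
move=> x0; have c0 := ltW weight_const_gt0.
exists (Num.bound (x * (4 * c))) => k k0k.
have := archi_boundP (mulr_ge0 x0 (mulr_ge0 (ler0n R 4) c0)).
set b := Num.bound _ in k0k *=> xb.
have kr : 0 < k%:R :> R by rewrite ltr0n; exact: leq_trans k0k.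
have bk : b%:R <= k%:R :> R by rewrite ler_nat ltnW.
apply: le_trans (ler_wpM2l x0 (weight_le_inv _)) _.
  exact: leq_trans k0k.
rewrite mulrA ler_pdivrMr// mul1r; exact: le_trans (ltW xb) bk.
Qed.

End ladder.

(** * Gaussian mass of shifted windows *)

Section gaussian.
Context (R : realType).
Local Notation r := (atom R).
Local Notation c := (weight_const R).
Local Open Scope ereal_scope.

Lemma std_normal_pdfE (x : R) :
  normal_pdf 0 1 x = (normal_peak 1 * expR (- x ^+ 2 / 2))%R.
Proof.
by rewrite normal_pdfE ?oner_eq0// /normal_fun subr0 expr1n.
Qed.

(** Length 1/2 times the minimum of the density on [1/2, 1]. *)
Definition window_mass : R := (normal_pdf 0 1 1 / 2)%R.

Lemma window_mass_gt0 : (0 < window_mass)%R.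
Proof.
by rewrite divr_gt0// std_normal_pdfE mulr_gt0 ?expR_gt0 ?normal_peak_gt0 ?oner_eq0.
Qed.

Let mpdf (A : set R) : measurable_fun A (EFin \o normal_pdf (0 : R) 1).
Proof. by apply/measurable_funTS/measurable_EFinP; exact: measurable_normal_pdf. Qed.

Let lebesgue_itv (a b : R) : (a <= b)%R ->
  (lebesgue_measure `[a, b] = (b - a)%:E).
Proof.
rewrite le_eqVlt => /predU1P[->|ab].
  by rewrite lebesgue_measure_itv/= lte_fin ltxx subrr.
by rewrite lebesgue_measure_itv/= lte_fin ab.
Qed.

Lemma std_gaussian_itv_le (a b M : R) : (a <= b)%R ->
  (forall u, a <= u <= b -> normal_pdf 0 1 u <= M)%R ->
  std_gaussian R `[a, b] <= (M * (b - a))%:E.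
Proof.
move=> ab pM; rewrite EFinM -lebesgue_itv// -integral_cst//.
apply: ge0_le_integral => //=.
- by move=> x _; rewrite lee_fin normal_pdf_ge0.
- exact: mpdf.
Qed.

Lemma std_gaussian_itv_ge (a b M : R) : (a <= b)%R -> (0 <= M)%R ->
  (forall u, a <= u <= b -> M <= normal_pdf 0 1 u)%R ->
  (M * (b - a))%:E <= std_gaussian R `[a, b].
Proof.
move=> ab M0 pM; rewrite EFinM -lebesgue_itv// -integral_cst//.
apply: ge0_le_integral => //=.
- exact: mpdf.
Qed.

Lemma shift_window k (x : R) :
  [set z | window k (x + z)%R] = `[(r k + 2^-1 - x)%R, (r k + 1 - x)%R]%classic.
Proof. by apply/seteqP; split => z; rewrite /window/= !in_itv/=; lra. Qed.

Lemma measurable_window k : measurable (window k : set R).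
Proof. exact: measurable_itv. Qed.

Lemma std_gaussian_own_window k :
  window_mass%:E <= std_gaussian R [set z | window k (r k + z)%R].
Proof.
rewrite shift_window [X in X <= _](_ : _ =
    (normal_pdf 0 1 1 * (r k + 1 - r k - (r k + 2^-1 - r k)))%:E); last first.
  by rewrite /window_mass; congr EFin; field.
apply: std_gaussian_itv_ge; [lra|exact: normal_pdf_ge0|] => u u1.
rewrite !std_normal_pdfE ler_wpM2l ?normal_peak_ge0// ler_expR; nra.
Qed.

(** The density is bounded by its supremum over the window: at each point
[tilt_peak] compares the atom j with the atom k, whose density varies on its own
window by the factor exp (3/8) <= 2 only. *)
Lemma std_gaussian_other_window j k : (0 < j)%N -> (0 < k)%N ->
  (weight R j)%:E * std_gaussian R [set z | window k (r j + z)%R] <=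
  (2 * 2^-1 ^+ ((j - k) + (k - j))%N * weight R k * window_mass)%:E.
Proof.
move=> j0 k0; have wj := weight_gt0 R j; have wk := weight_gt0 R k.
rewrite muleC -lee_pdivlMr// -EFinM shift_window.
pose M := (2 * 2^-1 ^+ ((j - k) + (k - j))%N * weight R k *
  normal_pdf 0 1 1 / weight R j)%R.
rewrite [X in _ <= X](_ : _ =
    (M * (r k + 1 - r j - (r k + 2^-1 - r j)))%:E); last first.
  by rewrite /M /window_mass; congr EFin; field; rewrite gt_eqF.
apply: std_gaussian_itv_le; [lra|] => u u1.
rewrite ler_pdivlMr// !std_normal_pdfE !weightE.
rewrite [leRHS](_ : _ = normal_peak 1 * c * (2 * 2^-1 ^+ ((j - k) + (k - j))%N *
  (expR (- eps R * r k ^+ 2) * expR (- 1 ^+ 2 / 2))))%R; last by ring.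
rewrite [leLHS](_ : _ = normal_peak 1 * c *
  (expR (- eps R * r j ^+ 2) * expR (- u ^+ 2 / 2)))%R; last by ring.
rewrite ler_wpM2l ?mulr_ge0 ?normal_peak_ge0 ?(ltW (weight_const_gt0 R))//.
rewrite -!expRD; pose y := (r j + u)%R.
have yk : y \in window k by rewrite inE /window/= in_itv/= /y; lra.
rewrite (_ : _ + _ = tilt j y)%R; last by rewrite /tilt /y; ring.
have := tilt_peak j0 k0 yk; rewrite -ler_expR => /le_trans; apply.
apply: (@le_trans _ _
    (expR (- eps R * r k ^+ 2 - 8^-1 - ((j - k) + (k - j))%N%:R)))%R.
  by rewrite ler_expR lerD2r /tilt /y; nra.
rewrite [X in (_ <= X)%R]mulrAC [X in (_ <= X)%R]mulrC [X in (X <= _)%R]expRD.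
rewrite [X in (X <= _)%R]mulrC ler_pM ?expR_ge0 ?expRN_nat_le//.
(* 3/8 = 1/2 - 1/8 is the variation of u^2 / 2 on [1/2, 1]. *)
have e : (2^-1 <= expR (- (3 / 8)) :> R)%R.
  by apply: le_trans (expR_ge1Dx _); lra.
rewrite (_ : - eps R * r k ^+ 2 + - 1 ^+ 2 / 2 =
  (- eps R * r k ^+ 2 - 8^-1) + - (3 / 8))%R; last by field.
rewrite [in leRHS]expRD; have := expR_gt0 (- eps R * r k ^+ 2 - 8^-1); nra.
Qed.

(** The atom 0 has mass at most 1 instead of a small weight, but its distance to
the window compensates for that: (r_k + 1/2)^2 / 2 >= r_k^2 / 4 + 1/2. *)
Lemma std_gaussian_window_from0 k : (0 < k)%N ->
  std_gaussian R [set z | window k (r 0 + z)%R] <=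
  (c^-1 * weight R k * window_mass)%:E.
Proof.
move=> k0; have c0 := weight_const_gt0 R; rewrite shift_window.
pose M := (c^-1 * weight R k * normal_pdf 0 1 1)%R.
rewrite [X in _ <= X](_ : _ =
    (M * (r k + 1 - r 0 - (r k + 2^-1 - r 0)))%:E); last first.
  by rewrite /M /window_mass; congr EFin; field; rewrite gt_eqF.
apply: std_gaussian_itv_le; [lra|] => u; rewrite subr0 => /andP[u1 _].
rewrite /M weightE mulKf ?gt_eqF// !std_normal_pdfE mulrCA.
rewrite ler_wpM2l ?normal_peak_ge0// -expRD ler_expR /eps.
have : (1 <= r k)%R by move: k0; case: (k) => // i _; exact: atomS_ge1.
nra.
Qed.

End gaussian.

(** * The law of the smoothed variable on the windows *)

Section discrete.
Context (R : realType).
Local Notation r := (atom R).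
Local Notation c := (weight_const R).
Local Open Scope ereal_scope.

(** As the probability of a singleton, the mass at 0 lies in [0, 1]. *)
Lemma discrete_law0E : discrete_law R [set r 0] = (mass R 0)%:E.
Proof.
apply/cvg_lim => //; rewrite -cvg_shiftS.
rewrite (_ : (fun n => _) = cst (mass R 0)%:E); first exact: cvg_cst.
apply/funext => n; rewrite big_ltn// diracE mem_set// mule1 big1_seq ?adde0//.
move=> j; rewrite mem_index_iota => /andP[_ /andP[j0 _]].
rewrite diracE memNset ?mule0// => /(@atom_inj R) j00.
by rewrite j00 in j0.
Qed.

Lemma mass_ge0 k : (0 <= mass R k)%R.
Proof.
case: k => [|k]; last exact/ltW/weight_gt0.
by rewrite -lee_fin -discrete_law0E.
Qed.

Lemma mass0_le1 : (mass R 0 <= 1)%R.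
Proof. by rewrite -lee_fin -discrete_law0E probability_le1. Qed.

Lemma integral_discrete_law (f : R -> \bar R) : measurable_fun setT f ->
  (forall x, 0 <= f x) ->
  \int[discrete_law R]_x f x = \sum_(0 <= k <oo) (mass R k)%:E * f (r k).
Proof.
move=> mf f0.
pose m k := mscale (NngNum (mass_ge0 k)) (\d_(r k) : {measure set R -> \bar R}).
rewrite (eq_measure_integral (mseries m 0))//.
rewrite ge0_integral_measure_series//; apply: eq_eseriesr => k _.
by rewrite ge0_integral_mscale// integral_dirac// diracT mul1e.
Qed.

Lemma discrete_law_atom_ge k : (0 < k)%N ->
  (weight R k)%:E <= discrete_law R [set r k].
Proof.
move=> k0; rewrite /discrete_law.
have t0 j : 0 <= (mass R j)%:E * \d_(r j) [set r k].
  by apply: mule_ge0; rewrite ?lee_fin ?mass_ge0.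
apply: le_trans (nneseries_lim_ge k.+1 _) => //.
rewrite big_nat_recr//= diracE mem_set// mule1.
by case: k k0 t0 => // k _ t0; rewrite leeDr// sume_ge0.
Qed.

(** Total contribution to a window, relative to that of its own atom, at most:
[c^-1] for the atom 0, and [2 * 3] for the others, 2 being the constant of
[std_gaussian_other_window] and 3 the sum of 2^(- |j - k|) over all j. *)
Definition overlap : R := (c^-1 + 6)%R.

Lemma overlap_gt0 : (0 < overlap)%R.
Proof. by rewrite addr_gt0// invr_gt0 weight_const_gt0. Qed.

Lemma convolution_window_le k : (0 < k)%N ->
  convolution (discrete_law R) (std_gaussian R) (window k) <=
  (overlap * weight R k * window_mass R)%:E.
Proof.
move=> k0; rewrite /convolution /distribution /pushforward.
have mW : measurable (@pair_add R @^-1` window k).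
  by rewrite -[_ @^-1` _]setTI; apply: measurable_funP => //; exact: measurable_window.
rewrite -[X in X <= _]/(\int[discrete_law R]_x
  (std_gaussian R \o xsection (@pair_add R @^-1` window k)) x).
rewrite integral_discrete_law//; last first.
  exact: measurable_fun_xsection.
have sec x : (std_gaussian R \o xsection (@pair_add R @^-1` window k)) x =
    std_gaussian R [set z | window k (x + z)%R].
  rewrite /=; congr std_gaussian.
  by apply/seteqP; split => z; rewrite /xsection/= inE.
apply: lime_le.
  apply: is_cvg_ereal_nneg_natsum => j _.
  by apply: mule_ge0; rewrite ?lee_fin ?mass_ge0.
apply: nearW => -[|n]; first rewrite big_geq// lee_fin.
  apply/ltW/mulr_gt0; last exact: window_mass_gt0.
  by apply: mulr_gt0; [exact: overlap_gt0|exact: weight_gt0].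
rewrite big_ltn// sec.
apply: (@le_trans _ _ ((c^-1 * weight R k * window_mass R)%:E +
  \sum_(1 <= j < n.+1)
    (2 * 2^-1 ^+ ((j - k) + (k - j))%N * weight R k * window_mass R)%:E)).
  apply: leeD.
    apply: (le_trans _ (@std_gaussian_window_from0 R k k0)).
    rewrite -[leRHS]mul1e lee_wpmul2r// lee_fin; exact: mass0_le1.
  rewrite big_nat_cond [leRHS]big_nat_cond.
  apply: lee_sum => j /andP[/andP[j0 _] _]; rewrite sec.
  by case: j j0 => // j _; exact: std_gaussian_other_window.
rewrite sumEFin -EFinD lee_fin -!mulr_suml -mulr_sumr.
rewrite -2!mulrDl ler_wpM2r ?(ltW (window_mass_gt0 R))//.
rewrite ler_wpM2r ?(ltW (weight_gt0 R k))// lerD2l.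
have := sum_geometric_two_sided R k n.+1; lra.
Qed.

End discrete.

(** * Divergence of both quantities *)

Section infinite.
Context (R : realType).
Local Notation r := (atom R).
Local Open Scope ereal_scope.

Lemma linear_lower_bound_infty (q : R) (x : \bar R) : (0 < q)%R ->
  (forall m : nat, (m%:R * q)%:E <= x) -> x = +oo.
Proof.
move=> q0 qx; apply/eqyP => A A0.
apply: le_trans (qx (Num.bound (A / q))); rewrite lee_fin -ler_pdivrMr//.
by apply/ltW/archi_boundP; rewrite divr_ge0 ?ltW.
Qed.

Lemma const_le_sum (q : R) m (f : 'I_m -> \bar R) :
  (forall k, q%:E <= f k) -> (m%:R * q)%:E <= \sum_(k < m) f k.
Proof.
move=> qf; apply: (@le_trans _ _ (\sum_(k < m) q%:E)); last exact: lee_sum.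
by rewrite sumEFin sumr_const card_ord mulr_natl.
Qed.

Lemma independent_sum_law d (Omega : measurableType d)
    (Pr : probability Omega R) (X Z Y : {RV Pr >-> R})
    (mu nu : probability R R) :
  has_law X mu -> has_law Z nu -> independent X Z ->
  (forall w, Y w = (X w + Z w)%R) -> has_law Y (convolution mu nu).
Proof.
move=> lX lZ XZ YE A mA.
rewrite /convolution /distribution /pushforward.
have mP : measurable (@pair_add R @^-1` A).
  by rewrite -[_ @^-1` _]setTI; exact: measurable_funP.
apply/esym/(etrans (@product_measure_unique _ _ _ _ _ mu nu
  (distribution Pr (pairRV X Z)) _ _ mP)).
  move=> B C mB mC; apply: etrans (XZ _ _ mB mC) _.
  exact: (f_equal2 mule (lX B mB) (lZ C mC)).
rewrite /distribution /pushforward; congr (Pr _).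
by apply/seteqP; split => w; rewrite /preimage/= /pair_add/= YE.
Qed.

(** On E_k = {r_k} x W_k, the joint law is P{r_k} times the mass of the window
around its own atom, and the product law is P{r_k} times Q W_k. *)
Lemma information_infty d (Omega : measurableType d)
    (Pr : probability Omega R) (S Z Y : {RV Pr >-> R}) :
  has_law S (discrete_law R) -> has_law Z (std_gaussian R) ->
  independent S Z -> (forall w, Y w = (S w + Z w)%R) ->
  chi2_information S Y = +oo.
Proof.
move=> lS lZ SZ YE.
have lY := @independent_sum_law _ _ _ _ _ _ _ _ lS lZ SZ YE.
have g0 := window_mass_gt0 R; have K0 := overlap_gt0 R.
have [k0 small] := @weight_eventually_small R (2 * overlap R)
  (mulr_ge0 (ler0n _ _) (ltW K0)).
apply: (@linear_lower_bound_infty (window_mass R / (4 * overlap R))%R).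
  by rewrite divr_gt0// mulr_gt0.
move=> m; pose idx (k : 'I_m) := (k0 + k).+1.
have idx0 k : (k0 < idx k)%N by rewrite /idx ltnS leq_addr.
pose w k : R := fine (discrete_law R [set r (idx k)]).
have wE k : discrete_law R [set r (idx k)] = (w k)%:E.
  by rewrite fineK// fin_num_measure.
have ww k : (weight R (idx k) <= w k)%R.
  by rewrite -lee_fin -wE; exact: discrete_law_atom_ge.
have p0 k := weight_gt0 R (idx k).
have w0 k : (0 < w k)%R := lt_le_trans (p0 k) (ww k).
pose a k : R := (w k * window_mass R)%R.
pose b k : R := (w k * (overlap R * weight R (idx k) * window_mass R))%R.
have b0 k : (0 < b k)%R by do !apply: mulr_gt0 => //.
apply: (@le_trans _ _ (\sum_(k < m) (a k ^+ 2 / (4 * b k))%:E)).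
  apply: const_le_sum => k; rewrite lee_fin /a /b.
  rewrite [leRHS](_ : _ = window_mass R / (4 * overlap R) *
    (w k / weight R (idx k)))%R; last first.
    by field; rewrite !gt_eqF.
  apply: ler_peMr; last by rewrite ler_pdivlMr ?mul1r.
  by apply/ltW/divr_gt0 => //; apply: mulr_gt0.
apply: (@sum_le_chi2 _ _ R _ _ m (fun k => [set r (idx k)] `*` window (idx k))).
- by move=> k; apply: measurableX => //; exact: measurable_window.
- move=> i j _ _ [[x y] [/= [xi _] [xj _]]].
  apply/val_inj/(@addnI k0)/succn_inj/(@atom_inj R).
  by rewrite -[LHS]xi -[RHS]xj.
- by [].
- move=> k; rewrite (_ : 2 * b k = a k * (2 * overlap R * weight R (idx k)))%R.
    by apply: ler_piMr; [exact/ltW/mulr_gt0|exact: small].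
  by rewrite /a /b; ring.
- move=> k.
  have mz : measurable [set z | window (idx k) (r (idx k) + z)%R].
    by rewrite shift_window; exact: measurable_itv.
  rewrite [leRHS](_ : _ = distribution Pr S [set r (idx k)] *
      distribution Pr Z [set z | window (idx k) (r (idx k) + z)%R]); last first.
    rewrite -[RHS]SZ//; congr (Pr _).
    by apply/seteqP; split => t; rewrite /preimage/= /pairRV/= YE => -[->].
  rewrite [distribution Pr S _](etrans (lS _ _) (wE k))// lZ// EFinM.
  apply: lee_wpmul2l; first by rewrite lee_fin ltW.
  exact: std_gaussian_own_window.
- move=> k; rewrite [leLHS](@product_measure1E _ _ _ _ _ (distribution Pr S)
    (distribution Pr Y))//; last exact: measurable_window.
  rewrite [leLHS](f_equal2 mule (etrans (lS _ _) (wE k))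
    (lY _ (measurable_window (idx k))))// EFinM.
  apply: lee_wpmul2l; first by rewrite lee_fin ltW.
  exact: convolution_window_le.
Qed.

(** The sample r_k, of empirical mass at least 1 / n, already fills W_k. *)
Lemma empirical_convolution_window n (s : n.+1.-tuple R) k :
  tnth s ord0 = r k ->
  (n.+1%:R^-1 * window_mass R)%:E <=
  convolution (empirical R s) (std_gaussian R) (window k).
Proof.
move=> sk.
have mz : measurable [set z | window k (r k + z)%R].
  by rewrite shift_window; exact: measurable_itv.
have mP : measurable (@pair_add R @^-1` window k).
  rewrite -[_ @^-1` _]setTI; apply: measurable_funP => //.
  exact: measurable_window.
apply: (@le_trans _ _ ((empirical R s \x std_gaussian R)
  ([set r k] `*` [set z | window k (r k + z)%R]))); last first.
  apply: le_measure; rewrite ?inE//; first exact: measurableX.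
  by move=> [x z] /= [-> ].
rewrite product_measure1E// EFinM; apply: lee_pmul.
- by rewrite lee_fin invr_ge0.
- by rewrite lee_fin ltW// window_mass_gt0.
- rewrite /empirical -[leLHS]mule1 lee_wpmul2l// ?lee_fin ?invr_ge0//.
  rewrite big_ord_recl/= sk diracE mem_set// leeDl// sume_ge0//.
- exact: std_gaussian_own_window.
Qed.

Lemma power_probability_head d (T : measurableType d) (P : probability T R) n
    (A : set T) : measurable A ->
  power_probability P n.+1 [set s | A (tnth s ord0)] = P A.
Proof.
move=> mA; pose B (i : 'I_n.+1) := if i == ord0 then A else setT.
rewrite (_ : [set s | _] = [set s : n.+1.-tuple T | forall i, B i (tnth s i)]).
  rewrite power_probability_box; last first.
    by move=> i; rewrite /B; case: ifP.
  rewrite big_ord_recl big1 ?mule1// => i _.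
  by rewrite /B/= probability_setT.
apply/seteqP; split => s /=.
  by move=> As i; rewrite /B; case: eqVneq => // ->.
by move/(_ ord0).
Qed.

Lemma measurable_head_event n k :
  measurable [set s : n.+1.-tuple R | tnth s ord0 = r k].
Proof.
rewrite (_ : [set s | _] = setT `&` (fun s => tnth s ord0) @^-1` [set r k]).
  by apply: measurable_tnth.
by rewrite setTI.
Qed.

(** The first sample is r_k with probability at least p_k, which offsets the
factor 1 / p_k in the lower bound for the divergence. *)
Lemma empirical_chi2_infty n :
  \int[power_probability (discrete_law R) n.+1]_s
    chi2 (convolution (empirical R s) (std_gaussian R))
         (convolution (discrete_law R) (std_gaussian R)) = +oo.
Proof.
have g0 := window_mass_gt0 R; have K0 := overlap_gt0 R.
have N0 : (0 < n.+1%:R :> R)%R by [].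
have [k0 small] := @weight_eventually_small R (2 * n.+1%:R * overlap R)
  (mulr_ge0 (mulr_ge0 (ler0n _ _) (ltW N0)) (ltW K0)).
apply: (@linear_lower_bound_infty
  (window_mass R / (4 * n.+1%:R ^+ 2 * overlap R))%R).
  by rewrite divr_gt0// !mulr_gt0.
move=> m; pose idx (k : 'I_m) := (k0 + k).+1.
have idx0 k : (k0 < idx k)%N by rewrite /idx ltnS leq_addr.
have p0 k := weight_gt0 R (idx k).
pose a : R := (n.+1%:R^-1 * window_mass R)%R.
pose b k : R := (overlap R * weight R (idx k) * window_mass R)%R.
have b0 k : (0 < b k)%R by do !apply: mulr_gt0 => //.
pose E (k : 'I_m) := [set s : n.+1.-tuple R | tnth s ord0 = r (idx k)].
apply: (@le_trans _ _ (\sum_(k < m) (a ^+ 2 / (4 * b k))%:E *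
    power_probability (discrete_law R) n.+1 (E k))).
  apply: const_le_sum => k.
  rewrite (@power_probability_head _ _ (discrete_law R) n [set r (idx k)])//.
  apply: (@le_trans _ _ ((a ^+ 2 / (4 * b k))%:E * (weight R (idx k))%:E)).
    rewrite -EFinM lee_fin le_eqVlt; apply/orP; left; apply/eqP.
    by rewrite /a /b; field; rewrite !gt_eqF.
  rewrite lee_wpmul2l ?discrete_law_atom_ge// lee_fin divr_ge0 ?sqr_ge0//.
  by rewrite mulr_ge0 ?ltW.
apply: sum_le_integral.
- by move=> s; exact: chi2_ge0.
- by move=> k; exact: measurable_head_event.
- move=> i j _ _ [s [/= si sj]].
  apply/val_inj/(@addnI k0)/succn_inj/(@atom_inj R).
  by rewrite -[LHS]si -[RHS]sj.
- by move=> k; rewrite divr_ge0 ?sqr_ge0// mulr_ge0 ?ltW.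
move=> k s /= sk.
have := @sum_le_chi2 _ _ R
  (convolution (empirical R s) (std_gaussian R))
  (convolution (discrete_law R) (std_gaussian R)) 1
  (fun=> window (idx k)) (fun=> a) (fun=> b k).
(* For a given sample, the single event W_k suffices. *)
rewrite big_ord1; apply => //.
- by move=> _; exact: measurable_window.
- by move=> i j _ _ _; rewrite !ord1.
- move=> _; rewrite (_ : 2 * b k =
      a * (2 * n.+1%:R * overlap R * weight R (idx k)))%R.
    by apply: ler_piMr; [apply/ltW/mulr_gt0; rewrite ?invr_gt0|exact: small].
  by rewrite /a /b; field; rewrite gt_eqF.
- by move=> _; exact: empirical_convolution_window.
- by move=> _; exact: convolution_window_le.
Qed.

End infinite.

Theorem proposition4 (R : realType) :
  (forall (d : measure_display) (Omega : measurableType d)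
      (Pr : probability Omega R) (S Z Y : {RV Pr >-> R}),
    has_law S (discrete_law R) ->
    has_law Z (std_gaussian R) ->
    independent S Z ->
    (forall w, Y w = S w + Z w) ->
    chi2_information S Y = +oo%E) /\
  (forall n : nat,
    (\int[power_probability (discrete_law R) n.+1]_s
       chi2 (convolution (empirical R s) (std_gaussian R))
            (convolution (discrete_law R) (std_gaussian R)) = +oo)%E).
Proof.
split=> [d Omega Pr S Z Y|n]; first exact: information_infty.
exact: empirical_chi2_infty.
Qed.
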